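(* Let $d$ be a real number with $0<d\leq 2\log(2)$. Then $\chi(\mathbb{H},d)\leq 9$.
   Context: $\mathbb{H}=\{(x,y)\in\mathbb{R}^2 : y>0\}$ is the hyperbolic plane (upper half-plane model) with distance $d_{\mathbb{H}}((x,y),(x',y'))=\operatorname{arccosh}\left(1+\frac{(x-x')^2+(y-y')^2}{2yy'}\right)$. For $d>0$, $\chi(\mathbb{H},d)$ denotes the minimal number of colors needed to color all points of $\mathbb{H}$ so that any two points at hyperbolic distance exactly $d$ receive different colors. *)

(* Defs.v *)
From Stdlib Require Import Reals Lra.
Open Scope R_scope.

(* Meaningful for [1 <= x]; see [cosh_arccosh] and [arccosh_ge0]. *)
Definition arccosh (x : R) : R := ln (x + sqrt (x ^ 2 - 1)).

Lemma arccosh_ge0 (x : R) : 1 <= x -> 0 <= arccosh x.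
Proof.
intros Hx; unfold arccosh.
pose proof (sqrt_pos (x ^ 2 - 1)).
rewrite <- ln_1.
destruct (Rle_lt_or_eq_dec 1 (x + sqrt (x ^ 2 - 1))) as [Hlt | <-]; [lra | | lra].
left; apply ln_increasing; lra.
Qed.

Lemma cosh_arccosh (x : R) : 1 <= x -> cosh (arccosh x) = x.
Proof.
intros Hx; unfold cosh, arccosh.
pose proof (sqrt_pos (x ^ 2 - 1)) as Hs.
assert (Hq : sqrt (x ^ 2 - 1) * sqrt (x ^ 2 - 1) = x ^ 2 - 1)
  by (apply sqrt_sqrt; nra).
rewrite exp_Ropp, exp_ln by lra.
set (s := sqrt (x ^ 2 - 1)) in *.
assert (Hi : / (x + s) = x - s).
{ apply Rmult_eq_reg_l with (x + s); [|lra].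
  rewrite Rinv_r by lra; nra. }
rewrite Hi; field.
Qed.

Definition Hplane : Type := {p : R * R | 0 < snd p}.

Definition re (p : Hplane) : R := fst (proj1_sig p).
Definition im (p : Hplane) : R := snd (proj1_sig p).

Definition dist_H (p q : Hplane) : R :=
  arccosh (1 + ((re p - re q) ^ 2 + (im p - im q) ^ 2) / (2 * im p * im q)).

Definition proper_coloring (d : R) (n : nat) (c : Hplane -> nat) : Prop :=
  (forall p, (c p < n)%nat) /\ (forall p q, dist_H p q = d -> c p <> c q).

Definition colorable (d : R) (n : nat) : Prop :=
  exists c : Hplane -> nat, proper_coloring d n c.

(* [is_chi_H d n] is the relation "chi(H, d) = n". *)
Definition is_chi_H (d : R) (n : nat) : Prop :=
  colorable d n /\ (forall m : nat, colorable d m -> (n <= m)%nat).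

(* Main.v *)
(** With [s = exp (d/2)], two points are at distance [d] exactly when
    [Δx² + Δy² = (s - 1/s)² y y'].  Cut the half-plane into horizontal strips
    [s^k <= y < s^(k+1)], and the [k]-th strip into cells of Euclidean width
    [s^k (s² - 1)/2].  The color is the pair (strip index mod 3, cell index
    mod 3).  Points of equal color in different strips are more than [d] apart
    because their heights are; in different cells of one strip they are more
    than [d] apart because the cells are wide enough at their top side.  Two
    points of one cell are less than [d] apart: after rescaling, the defect is
    convex in each height, so only the corners of the cell matter, and the
    bottom side is where [s <= 2] is needed. *)

Require Import Defs.
From Stdlib Require Import Reals Lra Lia ZArith Classical Wf_nat.
Open Scope R_scope.

Lemma floor_bounds (r : R) : IZR (Int_part r) <= r < IZR (Int_part r) + 1.
Proof. destruct (base_Int_part r); lra. Qed.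

Lemma chi_of_colorable (d : R) (n : nat) :
  colorable d n -> exists m, is_chi_H d m /\ (m <= n)%nat.
Proof.
intros Hn.
destruct (dec_inh_nat_subset_has_unique_least_element (colorable d)) as [m [[Hm Hmin] _]].
- intros k; apply classic.
- now exists n.
- exists m; split; [split|]; auto.
Qed.

(** Half-angle formula: the right side is [4 * sinh (d / 2) ^ 2]. *)
Lemma cosh_sub_1 (d : R) :
  2 * (cosh d - 1) = (exp (d / 2) - / exp (d / 2)) ^ 2.
Proof.
pose proof (exp_pos (d / 2)).
unfold cosh; rewrite exp_Ropp.
replace (exp d) with (exp (d / 2) * exp (d / 2)) by (rewrite <- exp_plus; f_equal; lra).
field; lra.
Qed.

Lemma dist_H_eq (d : R) (p q : Hplane) :
  dist_H p q = d ->
  (re p - re q) ^ 2 + (im p - im q) ^ 2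
  = (exp (d / 2) - / exp (d / 2)) ^ 2 * (im p * im q).
Proof.
intros <-.
assert (Hp : 0 < im p) by exact (proj2_sig p).
assert (Hq : 0 < im q) by exact (proj2_sig q).
rewrite <- cosh_sub_1; unfold dist_H.
set (N := (re p - re q) ^ 2 + (im p - im q) ^ 2).
assert (HN : 0 <= N / (2 * im p * im q)).
{ apply Rmult_le_pos; [apply Rplus_le_le_0_compat; apply pow2_ge_0|].
  left; apply Rinv_0_lt_compat; nra. }
rewrite cosh_arccosh by lra.
field; lra.
Qed.

(* The four products are the bilinear interpolation weights, and
   [(y - 1) * (s - y) >= 0] replaces the squares by linear terms. *)
Lemma cell_corners (s K W y y' : R) :
  1 < s -> 1 <= y <= s -> 1 <= y' <= s ->
  W <= K -> W <= K * (s * s) -> W + (s - 1) ^ 2 <= K * s ->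
  W + (y - y') ^ 2 <= K * (y * y').
Proof.
intros Hs Hy Hy' H1 H2 H3.
set (D11 := K - W); set (Dss := K * (s * s) - W).
set (D1s := K * s - W - (s - 1) ^ 2).
assert (E : (s - 1) ^ 2 * (K * (y * y') - W - (y - y') ^ 2)
  = D11 * ((s - y) * (s - y')) + Dss * ((y - 1) * (y' - 1))
    + D1s * ((s - y) * (y' - 1)) + D1s * ((y - 1) * (s - y'))
    + (s - 1) ^ 2 * ((y - 1) * (s - y)) + (s - 1) ^ 2 * ((y' - 1) * (s - y')))
  by (unfold D11, Dss, D1s; ring).
assert (0 < (s - 1) ^ 2) by nra.
assert (0 <= (s - 1) ^ 2 * (K * (y * y') - W - (y - y') ^ 2)).
{ rewrite E.
  assert (0 <= D11 /\ 0 <= Dss /\ 0 <= D1s) by (unfold D11, Dss, D1s; lra).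
  repeat apply Rplus_le_le_0_compat;
    repeat apply Rmult_le_pos; lra. }
apply Rnot_lt_le; intros Hlt; nra.
Qed.

Lemma same_cell (s K w x y y' : R) :
  1 < s <= 2 -> w = (s * s - 1) / 2 -> K * (s * s) = 4 * (w * w) ->
  1 <= y <= s -> 1 <= y' <= s -> - w < x < w ->
  x ^ 2 + (y - y') ^ 2 < K * (y * y').
Proof.
intros Hs Hw HK Hy Hy' Hx.
assert (Hx2 : x ^ 2 < w * w).
{ assert (0 < (w - x) * (w + x)) by (apply Rmult_lt_0_compat; lra); lra. }
(* Corner [y = y' = 1]: here [K = 4 * w^2 / s^2], and [s <= 2] is exactly what is needed. *)
assert (HKW : w * w <= K).
{ apply Rmult_le_reg_r with (s * s); [nra|].
  rewrite HK.
  assert (w * w * (s * s) <= w * w * 4) by (apply Rmult_le_compat_l; nra).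
  lra. }
enough (w * w + (y - y') ^ 2 <= K * (y * y')) by lra.
apply cell_corners with s; try tauto; try lra.
- nra.
- apply Rmult_le_reg_r with s; [lra|].
  replace (K * s * s) with (K * (s * s)) by ring.
  rewrite HK, Hw.
  (* Mixed corner: since [w = (s - 1) * (s + 1) / 2], a factor [(s - 1) ^ 2] splits off the
     inequality multiplied by [4 * s], and this cubic is what remains. *)
  assert (0 <= (s + 1) ^ 2 * (4 - s) - 4 * s) by nra.
  assert (0 <= (s - 1) ^ 2 * ((s + 1) ^ 2 * (4 - s) - 4 * s)).
  { apply Rmult_le_pos; [nra | assumption]. }
  nra.
Qed.

(** The term [K * (y * y')] is largest at the top side [y = y' = s], where it equals
    [(2 * w) ^ 2]. *)
Lemma far_cells (s K w x y y' : R) :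
  K * (s * s) = 4 * (w * w) -> 0 <= K -> 0 <= w ->
  0 < y <= s -> 0 < y' <= s -> 2 * w < x ->
  K * (y * y') < x ^ 2 + (y - y') ^ 2.
Proof.
intros HK HK0 Hw Hy Hy' Hx.
assert (y * y' <= s * s) by (apply Rmult_le_compat; lra).
assert (K * (y * y') <= K * (s * s)) by (apply Rmult_le_compat_l; lra).
assert (0 < (x - 2 * w) * (x + 2 * w)) by (apply Rmult_lt_0_compat; lra).
pose proof (pow2_ge_0 (y - y')); lra.
Qed.

(** As a quadratic in [y'], [(y - y') ^ 2 - (s - / s) ^ 2 * (y * y')] has roots [s^2 * y] and
    [y / s^2], so it is positive beyond the larger one. *)
Lemma far_strips (s x y y' : R) :
  1 < s -> 0 < y -> s * s * y < y' ->
  (s - / s) ^ 2 * (y * y') < x ^ 2 + (y - y') ^ 2.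
Proof.
intros Hs Hy Hy'.
assert (Hi : / s * s = 1) by (apply Rinv_l; lra).
assert (Hi0 : 0 < / s) by (apply Rinv_0_lt_compat; lra).
assert (Hi1 : / s < 1) by (apply Rmult_lt_reg_r with s; lra).
set (i := / s) in *.
assert (0 < (y' - s * s * y) * (y' - i * i * y)).
{ apply Rmult_lt_0_compat; [lra|].
  assert (i * i < 1) by nra. assert (1 < s * s) by nra. nra. }
(* The last two terms vanish once [i * s = 1]; they make the identity polynomial, so that [ring]
   applies. *)
assert ((y' - s * s * y) * (y' - i * i * y)
  = (y - y') ^ 2 - (s - i) ^ 2 * (y * y')
    + 2 * (1 - i * s) * (y * y') - (1 - (i * s) * (i * s)) * (y * y)) by ring.
rewrite Hi in *.
pose proof (pow2_ge_0 x); lra.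
Qed.

Definition strip (h : R) (p : Hplane) : Z := Int_part (ln (im p) / h).

Definition strip_base (h : R) (k : Z) : R := exp (IZR k * h).

(** Widths grow with the base of the strip, so the dilation by that base, an isometry, carries the
    cells over [1 <= y < exp h] to those of the strip. *)
Definition cell (h w : R) (p : Hplane) : Z :=
  Int_part (re p / (w * strip_base h (strip h p))).

Definition strip_cell_color (h w : R) (p : Hplane) : nat :=
  Z.to_nat (3 * (strip h p mod 3) + cell h w p mod 3).

Lemma strip_cell_color_lt (h w : R) (p : Hplane) : (strip_cell_color h w p < 9)%nat.
Proof.
unfold strip_cell_color.
pose proof (Z.mod_pos_bound (strip h p) 3 ltac:(lia)).
pose proof (Z.mod_pos_bound (cell h w p) 3 ltac:(lia)).
lia.
Qed.

Lemma strip_cell_color_inj (h w : R) (p q : Hplane) :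
  strip_cell_color h w p = strip_cell_color h w q ->
  (strip h p mod 3 = strip h q mod 3 /\ cell h w p mod 3 = cell h w q mod 3)%Z.
Proof.
unfold strip_cell_color; intros E.
pose proof (Z.mod_pos_bound (strip h p) 3 ltac:(lia)).
pose proof (Z.mod_pos_bound (cell h w p) 3 ltac:(lia)).
pose proof (Z.mod_pos_bound (strip h q) 3 ltac:(lia)).
pose proof (Z.mod_pos_bound (cell h w q) 3 ltac:(lia)).
lia.
Qed.

(** Two whole strips or cells lie in between: this yields the factor [s * s] of [far_strips] and the
    gap [2 * w] of [far_cells]. *)
Lemma mod3_eq_lt (a b : Z) : (a mod 3 = b mod 3 -> a < b -> a + 3 <= b)%Z.
Proof.
intros E L.
pose proof (Z.div_mod a 3 ltac:(lia)).
pose proof (Z.div_mod b 3 ltac:(lia)).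
lia.
Qed.

Lemma strip_base_succ (h : R) (k : Z) : strip_base h (k + 1) = exp h * strip_base h k.
Proof.
unfold strip_base; rewrite <- exp_plus, plus_IZR; f_equal; ring.
Qed.

Lemma strip_base_le (h : R) (k l : Z) :
  0 < h -> (k <= l)%Z -> strip_base h k <= strip_base h l.
Proof.
intros Hh Hkl; apply IZR_le in Hkl; unfold strip_base.
destruct (Req_dec (IZR k) (IZR l)) as [-> | Hne]; [lra|].
left; apply exp_increasing; nra.
Qed.

Lemma im_strip (h : R) (p : Hplane) :
  0 < h ->
  strip_base h (strip h p) <= im p < exp h * strip_base h (strip h p).
Proof.
intros Hh.
assert (Hp : 0 < im p) by exact (proj2_sig p).
rewrite <- strip_base_succ; unfold strip_base.
rewrite <- (exp_ln (im p)) by assumption.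
rewrite plus_IZR.
destruct (floor_bounds (ln (im p) / h)) as [H1 H2]; fold (strip h p) in H1, H2.
assert (E : ln (im p) / h * h = ln (im p)) by (field; lra).
split.
- destruct (Req_dec (IZR (strip h p) * h) (ln (im p))) as [-> | Hne]; [lra|].
  left; apply exp_increasing; nra.
- apply exp_increasing; nra.
Qed.

Lemma re_cell (h w : R) (p : Hplane) :
  0 < w ->
  IZR (cell h w p) * w <= re p / strip_base h (strip h p) < (IZR (cell h w p) + 1) * w.
Proof.
intros Hw.
set (b := strip_base h (strip h p)).
assert (Hb : 0 < b) by apply exp_pos.
destruct (floor_bounds (re p / (w * b))) as [H1 H2].
fold b (cell h w p) in H1, H2.
replace (re p / b) with (re p / (w * b) * w) by (field; lra).
split; [apply Rmult_le_compat_r | apply Rmult_lt_compat_r]; try lra; assumption.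
Qed.

Lemma strip_cell_coloring (d : R) :
  0 < d <= 2 * ln 2 ->
  proper_coloring d 9
    (strip_cell_color (d / 2) ((exp (d / 2) * exp (d / 2) - 1) / 2)).
Proof.
intros Hd.
set (h := d / 2); set (s := exp h); set (w := (s * s - 1) / 2).
assert (Hh : 0 < h) by (unfold h; lra).
assert (Hs1 : 1 < s) by (unfold s; rewrite <- exp_0; apply exp_increasing; lra).
assert (Hs2 : s <= 2).
{ unfold s; rewrite <- (exp_ln 2) by lra.
  destruct (Req_dec h (ln 2)) as [-> | Hne]; [lra|].
  left; apply exp_increasing; unfold h in *; lra. }
assert (Hw : 0 < w) by (unfold w; nra).
set (K := (s - / s) ^ 2).
assert (HK0 : 0 <= K) by apply pow2_ge_0.
assert (HK : K * (s * s) = 4 * (w * w)) by (unfold K, w; field; lra).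
split; [intros p; apply strip_cell_color_lt|].
intros p q Hpq Hc.
apply dist_H_eq in Hpq; fold h s K in Hpq.
apply strip_cell_color_inj in Hc; destruct Hc as [Hk Hj].
assert (Hp : 0 < im p) by exact (proj2_sig p).
assert (Hq : 0 < im q) by exact (proj2_sig q).
pose proof (im_strip h p Hh) as Ip; pose proof (im_strip h q Hh) as Iq.
fold s in Ip, Iq.
assert (far : forall a b : Hplane,
  (strip h a mod 3 = strip h b mod 3)%Z -> (strip h a < strip h b)%Z ->
  s * s * im a < im b).
{ intros a b E L.
  pose proof (im_strip h a Hh) as [_ Ia]; pose proof (im_strip h b Hh) as [Ib _].
  pose proof (strip_base_le h _ _ Hh (mod3_eq_lt _ _ E L)) as Hab.
  replace (strip h a + 3)%Z with (strip h a + 1 + 1 + 1)%Z in Hab by ring.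
  rewrite !strip_base_succ in Hab; fold s in Hab, Ia.
  assert (s * s * im a < s * s * (s * strip_base h (strip h a)))
    by (apply Rmult_lt_compat_l; nra).
  lra. }
destruct (Z.lt_trichotomy (strip h p) (strip h q)) as [L | [E | L]].
- pose proof (far_strips s (re p - re q) _ _ Hs1 Hp (far _ _ Hk L)) as F.
  fold K in F; lra.
- pose proof (re_cell h w p Hw) as Rp; pose proof (re_cell h w q Hw) as Rq.
  rewrite E in Ip, Rp.
  set (b := strip_base h (strip h q)) in *.
  assert (Hb : 0 < b) by apply exp_pos.
  (* Dividing by [b] moves the common strip to base height 1; the distance equation is homogeneous
     and survives as [N]. *)
  assert (scale : forall a : Hplane, b <= im a < s * b -> 1 <= im a / b <= s).
  { intros a Ha; replace (im a) with (im a / b * b) in Ha by (field; lra).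
    split; apply Rmult_le_reg_r with b; lra. }
  apply scale in Ip; apply scale in Iq.
  assert (N : (re p / b - re q / b) ^ 2 + (im p / b - im q / b) ^ 2
              = K * (im p / b * (im q / b))).
  { replace (K * (im p / b * (im q / b))) with (K * (im p * im q) / (b * b))
      by (field; lra).
    rewrite <- Hpq; field; lra. }
  set (x := re p / b) in *; set (x' := re q / b) in *.
  set (y := im p / b) in *; set (y' := im q / b) in *.
  destruct (Z.lt_trichotomy (cell h w p) (cell h w q)) as [L | [Ec | L]].
  + apply mod3_eq_lt in L; [|assumption].
    apply IZR_le in L; rewrite plus_IZR in L.
    (* Strict because cells are half-open: [x] lies strictly left of the right end of its cell. *)
    assert (Hx : 2 * w < x' - x) by nra.
    pose proof (far_cells s K w (x' - x) y y' HK HK0 ltac:(lra)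
      ltac:(lra) ltac:(lra) Hx).
    nra.
  + rewrite Ec in Rp.
    pose proof (same_cell s K w (x - x') y y' ltac:(lra) eq_refl HK Ip Iq
      ltac:(lra)).
    lra.
  + apply mod3_eq_lt in L; [|now symmetry].
    apply IZR_le in L; rewrite plus_IZR in L.
    assert (Hx : 2 * w < x - x') by nra.
    pose proof (far_cells s K w (x - x') y y' HK HK0 ltac:(lra)
      ltac:(lra) ltac:(lra) Hx).
    lra.
- pose proof (far_strips s (re p - re q) _ _ Hs1 Hq (far _ _ (eq_sym Hk) L)) as F.
  fold K in F; nra.
Qed.

Theorem mainTheorem1 (d : R) (hd0 : 0 < d) (hd : d <= 2 * ln 2) :
  exists n : nat, is_chi_H d n /\ (n <= 9)%nat.
Proof.
apply chi_of_colorable.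
eexists; apply strip_cell_coloring; lra.
Qed.
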